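(* Let $\mathcal{S}^2_n\subset\mathcal{C}^{\binom{n+1}{2}}$ be the variety of symmetric $n\times n$ matrices over $\mathcal{C}$ of rank at most $2$. Then its real and complex tropicalizations coincide: $$\mathrm{trop}_{\mathcal{R}}(\mathcal{S}^2_n)=\mathrm{trop}_{\mathcal{C}}(\mathcal{S}^2_n).$$
   Context: Let $\mathcal{C}=\mathbb{C}\{\!\{t\}\!\}$ and $\mathcal{R}=\mathbb{R}\{\!\{t\}\!\}$ be the fields of complex and real Puiseux series, with valuation $\mathrm{val}(a)$ = the exponent of the lowest degree term of $a\ne0$. For a variety $X\subset\mathcal{C}^N$ and $\mathcal{K}\in\{\mathcal{C},\mathcal{R}\}$, let $\mathrm{trop}_{\mathcal{K}}(X)=\overline{\{\mathrm{val}(x): x\in X\cap(\mathcal{K}^* )^N\}}\subset\mathbb{R}^N$, with coordinatewise valuation and Euclidean closure. The coordinates on the space of symmetric matrices are the entries on and above the diagonal. *)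

(* Defs.v *)
From HB Require Import structures.
From mathcomp Require Import all_boot all_order all_algebra.
From mathcomp Require Import all_classical all_reals all_analysis.
From mathcomp Require Import complex.
From mathcomp Require Import ring zify.

Set Implicit Arguments.
Unset Strict Implicit.
Unset Printing Implicit Defensive.

Import Order.TTheory GRing.Theory Num.Theory.
Import numFieldNormedType.Exports.

Local Open Scope classical_set_scope.
Local Open Scope ring_scope.

(* Exponents (m + k) / d, k = 0, 1, ..., with common denominator d. *)
Definition pexp (d : nat) (m : int) (k : nat) : rat :=
  (m + k%:Z)%:~R / d%:R.

Definition psupported (F : fieldType) (d : nat) (m : int) (f : rat -> F) : Prop :=
  forall q, f q != 0 -> exists k, q = pexp d m k.

Definition is_puiseux (F : fieldType) (f : rat -> F) : Prop :=
  exists d m, (0 < d)%N /\ psupported d m f.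

(* A formal Puiseux series sum_q f(q) t^q is encoded by its coefficient
   function f : rat -> F; the union of the fields F((t^(1/d))), d > 0, is the
   set of those f whose support lies in some (m + nat) / d. *)
Record puiseux (F : fieldType) : Type := Puiseux {
  pcoef :> rat -> F;
  _ : `[< is_puiseux pcoef >] }.

Section PuiseuxSupport.
Variable F : fieldType.
Implicit Types (f g h : rat -> F) (d : nat) (m : int).

Lemma pexp_inj d m : (0 < d)%N -> injective (pexp d m).
Proof.
move=> d0 i j /(congr1 (fun x => x * d%:R)).
rewrite /pexp !divfK ?pnatr_eq0 -?lt0n// => /intr_inj; lia.
Qed.

Lemma pexpD d m1 m2 i j : pexp d m1 i + pexp d m2 j = pexp d (m1 + m2) (i + j).
Proof. by rewrite /pexp -mulrDl -intrD PoszD; congr (_%:~R / _); lia. Qed.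

Lemma pexpB d m1 m2 i k : (i <= k)%N ->
  pexp d (m1 + m2) k - pexp d m1 i = pexp d m2 (k - i).
Proof. by move=> ik; rewrite -[in pexp _ _ k](subnKC ik) -pexpD; ring. Qed.

Lemma psupportedW d m m' f : m' <= m -> psupported d m f -> psupported d m' f.
Proof.
move=> mm' sf q /sf[k ->]; exists (`|m - m'|%N + k)%N.
by rewrite /pexp; congr (_%:~R / _); lia.
Qed.

Lemma psupported_mul d e m f : (0 < e)%N -> psupported d m f ->
  psupported (d * e) (m * e%:Z) f.
Proof.
move=> e0 sf q /sf[k ->]; exists (k * e)%N.
rewrite /pexp PoszM -mulrDl intrM natrM -mulf_div divff ?mulr1//.
by rewrite pnatr_eq0 -lt0n.
Qed.

Lemma psupported_ext d m f g : psupported d m f -> psupported d m g ->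
  (forall k, f (pexp d m k) = g (pexp d m k)) -> f = g.
Proof.
move=> sf sg fg; apply/funext => q.
have [f0|/sf[k ->]] := eqVneq (f q) 0; last exact: fg.
have [->//|/sg[k qk]] := eqVneq (g q) 0.
by rewrite qk fg.
Qed.

Lemma psupported_common2 f g : is_puiseux f -> is_puiseux g ->
  exists d m1 m2, [/\ (0 < d)%N, psupported d m1 f & psupported d m2 g].
Proof.
move=> [d1 [m1 [d10 sf]]] [d2 [m2 [d20 sg]]].
exists (d1 * d2)%N, (m1 * d2%:Z), (m2 * d1%:Z); split.
- by rewrite muln_gt0 d10.
- exact: psupported_mul.
- by rewrite mulnC; exact: psupported_mul.
Qed.

Lemma psupported_common3 f g h : is_puiseux f -> is_puiseux g -> is_puiseux h ->
  exists d m1 m2 m3, [/\ (0 < d)%N, psupported d m1 f, psupported d m2 g &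
    psupported d m3 h].
Proof.
move=> pf pg [d3 [m3 [d30 sh]]].
have [d [m1 [m2 [d0 sf sg]]]] := psupported_common2 pf pg.
exists (d * d3)%N, (m1 * d3%:Z), (m2 * d3%:Z), (m3 * d%:Z); split.
- by rewrite muln_gt0 d0.
- exact: psupported_mul.
- exact: psupported_mul.
- by rewrite mulnC; exact: psupported_mul.
Qed.

Lemma psupportedD d m f g : psupported d m f -> psupported d m g ->
  psupported d m (fun q => f q + g q).
Proof.
move=> sf sg q; have [->|/sf//] := eqVneq (f q) 0.
by rewrite add0r => /sg.
Qed.

(* Cauchy product; for Puiseux series the sum has finite support. *)
Definition pmul f g (q : rat) : F := \sum_(p \in [set: rat]) f p * g (q - p).

Lemma psupported_pmul d m1 m2 f g :
  psupported d m1 f -> psupported d m2 g -> psupported d (m1 + m2) (pmul f g).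
Proof.
move=> sf sg q; apply: contra_neqP => nq; apply: fsbig1 => p _.
apply: contra_notP nq => /eqP; rewrite mulf_eq0 => /norP[/sf[i pi] /sg[j pj]].
by exists (i + j)%N; rewrite -pexpD -pi -pj; ring.
Qed.

Lemma pmulE d m1 m2 f g k : (0 < d)%N ->
  psupported d m1 f -> psupported d m2 g ->
  pmul f g (pexp d (m1 + m2) k) =
  \sum_(i < k.+1) f (pexp d m1 i) * g (pexp d m2 (k - i)).
Proof.
move=> d0 sf sg; rewrite /pmul.
rewrite -(fsbig_widen [set` [seq pexp d m1 i | i <- iota 0 k.+1]])//; last first.
  move=> p [_ /= np].
  apply: contra_notP np => /eqP; rewrite mulf_eq0 => /norP[/sf[i pi] /sg[j pj]].
  rewrite pi; apply: (map_f (pexp d m1) (s := iota 0 k.+1)).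
  rewrite mem_iota add0n leq0n/= ltnS.
  have : pexp d (m1 + m2) k = pexp d (m1 + m2) (i + j).
    by rewrite -pexpD -pi -pj; ring.
  by move/(pexp_inj d0) => ->; exact: leq_addr.
rewrite -fsbig_seq ?map_inj_uniq ?iota_uniq//; last exact: pexp_inj.
rewrite big_map -[iota 0 k.+1]/(index_iota 0 k.+1) big_mkord.
by apply: eq_bigr => i _; rewrite pexpB// -ltnS.
Qed.

(* Truncations to polynomials reduce the ring axioms to those of {poly F}. *)
Let T d m n f : {poly F} := \poly_(i < n) f (pexp d m i).

Let coefT d m n f k : (k < n)%N -> (T d m n f)`_k = f (pexp d m k).
Proof. by move=> kn; rewrite coef_poly kn. Qed.

Let pmulT d m1 m2 n f g k : (0 < d)%N -> (k < n)%N ->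
  psupported d m1 f -> psupported d m2 g ->
  pmul f g (pexp d (m1 + m2) k) = (T d m1 n f * T d m2 n g)`_k.
Proof.
move=> d0 kn sf sg; rewrite (pmulE _ d0 sf sg) coefM.
by apply: eq_bigr => i _; rewrite !coefT//; have := ltn_ord i; lia.
Qed.

Lemma is_puiseux_pmul f g : is_puiseux f -> is_puiseux g ->
  is_puiseux (pmul f g).
Proof.
move=> pf pg; have [d [m1 [m2 [d0 sf sg]]]] := psupported_common2 pf pg.
by exists d, (m1 + m2); split => //; exact: psupported_pmul.
Qed.

Lemma pmulC f g : is_puiseux f -> is_puiseux g -> pmul f g = pmul g f.
Proof.
move=> pf pg; have [d [m1 [m2 [d0 sf sg]]]] := psupported_common2 pf pg.
apply: (psupported_ext (psupported_pmul sf sg)).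
  by rewrite addrC; exact: psupported_pmul.
move=> k; rewrite (pmulT d0 (ltnSn k) sf sg) mulrC.
by rewrite [m1 + m2]addrC (pmulT d0 (ltnSn k) sg sf).
Qed.

Lemma pmulA f g h : is_puiseux f -> is_puiseux g -> is_puiseux h ->
  pmul f (pmul g h) = pmul (pmul f g) h.
Proof.
move=> pf pg ph.
have [d [m1 [m2 [m3 [d0 sf sg sh]]]]] := psupported_common3 pf pg ph.
have sfg := psupported_pmul sf sg; have sgh := psupported_pmul sg sh.
apply: (psupported_ext (psupported_pmul sf sgh)).
  by rewrite addrA; exact: psupported_pmul.
move=> k; rewrite (pmulT d0 (ltnSn k) sf sgh) addrA.
rewrite (pmulT d0 (ltnSn k) sfg sh).
transitivity ((T d m1 k.+1 f * (T d m2 k.+1 g * T d m3 k.+1 h))`_k).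
  rewrite !coefM; apply: eq_bigr => i _; congr (_ * _).
  have ik : (k - i < k.+1)%N by rewrite ltnS leq_subr.
  by rewrite coefT// (pmulT d0 ik sg sh).
rewrite mulrA !coefM; apply: eq_bigr => i _; congr (_ * _).
by rewrite coefT// (pmulT d0 (ltn_ord i) sf sg).
Qed.

Lemma pmulDl f g h : is_puiseux f -> is_puiseux g -> is_puiseux h ->
  pmul (fun q => f q + g q) h = (fun q => pmul f h q + pmul g h q).
Proof.
move=> pf pg ph.
have [d [m1 [m2 [m3 [d0 sf sg sh]]]]] := psupported_common3 pf pg ph.
have {}sf : psupported d (Num.min m1 m2) f.
  by apply: psupportedW sf; rewrite ge_min lexx.
have {}sg : psupported d (Num.min m1 m2) g.
  by apply: psupportedW sg; rewrite ge_min lexx orbT.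
have sfg := psupportedD sf sg.
apply: (psupported_ext (psupported_pmul sfg sh)).
  by apply: psupportedD; exact: psupported_pmul.
move=> k; rewrite (pmulE _ d0 sfg sh) (pmulE _ d0 sf sh) (pmulE _ d0 sg sh).
by rewrite -big_split; apply: eq_bigr => i _; rewrite mulrDl.
Qed.

Definition pmonom (c : F) (r q : rat) : F := if q == r then c else 0.

Lemma psupported_const c d : psupported d 0 (pmonom c 0).
Proof.
move=> q; rewrite /pmonom; case: (q =P 0) => [-> _|]; last by rewrite eqxx.
by exists 0%N; rewrite /pexp mul0r.
Qed.

Lemma pexp_eq0 d k : (0 < d)%N -> (pexp d 0 k == 0) = (k == 0)%N.
Proof.
move=> d0; rewrite /pexp add0r mulf_eq0 invr_eq0 -pmulrn !pnatr_eq0.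
by rewrite -[d == 0%N]leqn0 leqNgt d0 orbF.
Qed.

Lemma pmul1 f : is_puiseux f -> pmul (pmonom 1 0) f = f.
Proof.
move=> [d [m [d0 sf]]]; have s1 := @psupported_const 1 d.
apply: (psupported_ext (psupported_pmul s1 sf)); first by rewrite add0r.
move=> k; rewrite (pmulE _ d0 s1 sf) big_ord_recl big1 ?addr0.
  by rewrite /pmonom pexp_eq0// eqxx mul1r subn0 add0r.
by move=> i _; rewrite /pmonom pexp_eq0// mul0r.
Qed.

Section Inverse.
Variable a : nat -> F.

Fixpoint inv_seq (n : nat) : seq F :=
  if n is n'.+1 then
    rcons (inv_seq n')
      (- (a 0%N)^-1 * \sum_(i < n) a i.+1 * (inv_seq n')`_(n' - i))
  else [:: (a 0%N)^-1].

Let size_inv_seq n : size (inv_seq n) = n.+1.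
Proof. by elim: n => //= n IH; rewrite size_rcons IH. Qed.

Let inv_seq_nth n k : (k <= n)%N -> (inv_seq n)`_k = (inv_seq k)`_k.
Proof.
elim: n => [|n IH]; first by rewrite leqn0 => /eqP ->.
rewrite leq_eqVlt => /predU1P[->//|]; rewrite ltnS => kn.
by rewrite /= nth_rcons size_inv_seq ltnS kn IH.
Qed.

Lemma inv_seqP n : a 0%N != 0 ->
  \sum_(i < n.+1) a i * (inv_seq (n - i))`_(n - i) = (n == 0)%N%:R.
Proof.
move=> a0; rewrite big_ord_recl subn0; case: n => [|n].
  by rewrite big_ord0 addr0 divff.
rewrite [X in a _ * X]/= nth_rcons size_inv_seq ltnn eqxx mulrA mulrN divff// mulN1r.
apply/eqP; rewrite addrC subr_eq0; apply/eqP/eq_bigr => i _.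
rewrite lift0 subSS [in RHS]inv_seq_nth//.
exact: leq_subr.
Qed.

End Inverse.

Lemma puiseux_lead f : is_puiseux f -> (exists q, f q != 0) ->
  exists d m, [/\ (0 < d)%N, psupported d m f & f (pexp d m 0) != 0].
Proof.
move=> [d [m [d0 sf]]] [q fq].
have ex : exists k, f (pexp d m k) != 0.
  by have [k qk] := sf _ fq; exists k; rewrite -qk.
case: (ex_minnP ex) => k fk kmin; exists d, (m + k%:Z); split => //.
- move=> r fr; have [j rj] := sf _ fr.
  have /kmin kj : f (pexp d m j) != 0 by rewrite -rj.
  by exists (j - k)%N; rewrite rj /pexp; congr (_%:~R / _); lia.
- by rewrite /pexp addr0.
Qed.

Lemma pmul_inv_ex f : is_puiseux f -> (exists q, f q != 0) ->
  exists g, is_puiseux g /\ pmul g f = pmonom 1 0.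
Proof.
move=> pf /(puiseux_lead pf)[d [m [d0 sf f0]]].
pose a k := f (pexp d m k); pose b k := (inv_seq a k)`_k.
pose g (q : rat) := let x := q * d%:R + m%:~R in
  if x \is a Num.nat then b (Num.truncn x) else 0.
have dn0 : d%:R != 0 :> rat by rewrite pnatr_eq0 -lt0n.
have sg : psupported d (- m) g.
  move=> q; rewrite /g; case: ifPn => [/natrP[k xk] _|]; last by rewrite eqxx.
  exists k; rewrite /pexp intrD intrN -pmulrn -xk.
  by rewrite addrCA addNr addr0 mulfK.
have gk k : g (pexp d (- m) k) = b k.
  rewrite /g /pexp divfK// intrD intrN addrAC addNr add0r -pmulrn natr_nat.
  by rewrite natrK.
have pg : is_puiseux g by exists d, (- m).
exists g; split => //; rewrite pmulC//.
have s1 := @psupported_const 1 d.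
apply: (psupported_ext (d := d) (m := 0)) => //.
  by rewrite -(subrr m); exact: psupported_pmul.
move=> k; rewrite -[X in pexp d X k](subrr m) (pmulE _ d0 sf sg) subrr.
rewrite /pmonom pexp_eq0//.
transitivity ((k == 0)%N%:R : F); last by case: eqP.
by rewrite -(@inv_seqP a k f0); apply: eq_bigr => i _; rewrite gk.
Qed.

End PuiseuxSupport.

Section PuiseuxField.
Variable F : fieldType.
Local Notation P := (puiseux F).
Implicit Types a b c : P.

HB.instance Definition _ := [isSub for @pcoef F].
HB.instance Definition _ := [Choice of P by <:].

Lemma puiseuxP a : is_puiseux a.
Proof. by case: a => f /= /asboolP. Qed.

Lemma puiseux_ext a b : (forall q, a q = b q) -> a = b.
Proof. by move=> ab; apply/val_inj/funext. Qed.

Definition mk_puiseux (f : rat -> F) (pf : is_puiseux f) : P :=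
  Puiseux (introT (asboolP _) pf).

Lemma is_puiseux0 : is_puiseux (fun _ => 0 : F).
Proof. by exists 1%N, 0; split=> // q; rewrite eqxx. Qed.

Lemma is_puiseuxN a : is_puiseux (fun q => - a q).
Proof.
have [d [m [d0 sa]]] := puiseuxP a.
by exists d, m; split => // q; rewrite oppr_eq0 => /sa.
Qed.

Lemma is_puiseuxD a b : is_puiseux (fun q => a q + b q).
Proof.
have [d [m1 [m2 [d0 sa sb]]]] := psupported_common2 (puiseuxP a) (puiseuxP b).
exists d, (Num.min m1 m2); split => //; apply: psupportedD.
  by apply: psupportedW sa; rewrite ge_min lexx.
by apply: psupportedW sb; rewrite ge_min lexx orbT.
Qed.

Definition puiseux_zero : P := mk_puiseux is_puiseux0.
Definition puiseux_opp a : P := mk_puiseux (is_puiseuxN a).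
Definition puiseux_add a b : P := mk_puiseux (is_puiseuxD a b).

Lemma puiseux_addA : associative puiseux_add.
Proof. by move=> a b c; apply: puiseux_ext => q /=; rewrite addrA. Qed.
Lemma puiseux_addC : commutative puiseux_add.
Proof. by move=> a b; apply: puiseux_ext => q /=; rewrite addrC. Qed.
Lemma puiseux_add0 : left_id puiseux_zero puiseux_add.
Proof. by move=> a; apply: puiseux_ext => q /=; rewrite add0r. Qed.
Lemma puiseux_addN : left_inverse puiseux_zero puiseux_opp puiseux_add.
Proof. by move=> a; apply: puiseux_ext => q /=; rewrite addNr. Qed.

HB.instance Definition _ := GRing.isZmodule.Build P
  puiseux_addA puiseux_addC puiseux_add0 puiseux_addN.

(* The monomial c t^r. *)
Lemma is_puiseux_monom (c : F) (r : rat) : is_puiseux (pmonom c r).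
Proof.
exists `|denq r|%N, (numq r); split; first by rewrite absz_gt0 denq_neq0.
move=> q; rewrite /pmonom; case: (q =P r) => [-> _|]; last by rewrite eqxx.
by exists 0%N; rewrite /pexp addr0 pmulrn absz_denq divq_num_den.
Qed.

Definition puiseux_monom (c : F) (r : rat) : P :=
  mk_puiseux (is_puiseux_monom c r).
Definition puiseux_mul a b : P :=
  mk_puiseux (is_puiseux_pmul (puiseuxP a) (puiseuxP b)).

Lemma puiseux_mulA : associative puiseux_mul.
Proof.
move=> a b c; apply: val_inj => /=.
by rewrite pmulA//; exact: puiseuxP.
Qed.
Lemma puiseux_mulC : commutative puiseux_mul.
Proof.
move=> a b; apply: val_inj => /=.
by rewrite pmulC//; exact: puiseuxP.
Qed.
Lemma puiseux_mul1 : left_id (puiseux_monom 1 0) puiseux_mul.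
Proof.
move=> a; apply: val_inj => /=.
by rewrite pmul1//; exact: puiseuxP.
Qed.
Lemma puiseux_mulDl : left_distributive puiseux_mul puiseux_add.
Proof.
move=> a b c; apply: val_inj => /=.
by rewrite pmulDl//; exact: puiseuxP.
Qed.
Lemma puiseux_1neq0 : puiseux_monom 1 0 != 0.
Proof.
apply/eqP => /(congr1 (fun a : P => a 0)) /=.
by rewrite /pmonom eqxx => /eqP; rewrite oner_eq0.
Qed.

HB.instance Definition _ := GRing.Zmodule_isComNzRing.Build P
  puiseux_mulA puiseux_mulC puiseux_mul1 puiseux_mulDl puiseux_1neq0.

Lemma puiseux_neq0 a : a != 0 -> exists q, a q != 0.
Proof.
move=> /eqP a0; apply: contra_notP a0 => na; apply: puiseux_ext => q /=.
by apply: contra_notP na => /eqP aq; exists q.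
Qed.

Lemma puiseux_inv_ex a : a != 0 -> exists b, b * a = 1.
Proof.
move=> /puiseux_neq0/(pmul_inv_ex (puiseuxP a))[g [pg ga]].
by exists (mk_puiseux pg); apply: val_inj.
Qed.

Definition puiseux_inv a : P :=
  if a == 0 then 0 else xget 0 [set b | b * a = 1].

Lemma puiseux_mulV a : a != 0 -> puiseux_inv a * a = 1.
Proof.
move=> a0; rewrite /puiseux_inv (negbTE a0).
by have [b ba] := puiseux_inv_ex a0; case: xgetP => [c _ //|/(_ b)].
Qed.

Lemma puiseux_inv0 : puiseux_inv 0 = 0.
Proof. by rewrite /puiseux_inv eqxx. Qed.

HB.instance Definition _ :=
  GRing.ComNzRing_isField.Build P puiseux_mulV puiseux_inv0.

(* Exponent of the lowest degree term; the value at 0 is irrelevant. *)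
Definition pval a : rat :=
  xget 0 [set q | a q != 0 /\ forall r, r < q -> a r = 0].

Lemma pvalP a : a != 0 -> a (pval a) != 0 /\ forall r, r < pval a -> a r = 0.
Proof.
move=> /puiseux_neq0/(puiseux_lead (puiseuxP a))[d [m [d0 sa am]]].
rewrite /pval; case: xgetP => [q -> //|/(_ (pexp d m 0))[]].
split => // r; apply: contraPeq => /sa[k ->]; apply/negP; rewrite -leNgt.
by rewrite ler_pM2r ?invr_gt0 ?ltr0n// ler_int; lia.
Qed.

End PuiseuxField.

Section MapPuiseux.
Variables (F G : fieldType) (iota : {rmorphism F -> G}).

Lemma is_puiseux_map (a : puiseux F) : is_puiseux (fun q => iota (a q)).
Proof.
have [d [m [d0 sa]]] := puiseuxP a.
by exists d, m; split => // q; rewrite fmorph_eq0 => /sa.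
Qed.

Definition map_puiseux (a : puiseux F) : puiseux G :=
  mk_puiseux (is_puiseux_map a).

End MapPuiseux.

Section Tropicalization.
Variable R : realType.

Definition complex_puiseux : fieldType := puiseux R[i].
Definition real_puiseux : fieldType := puiseux R.

Definition real_in_complex_puiseux : real_puiseux -> complex_puiseux :=
  map_puiseux (real_complex R).

Definition coord_val (N : nat) (x : 'rV[complex_puiseux]_N) : 'rV[R]_N :=
  \row_j ratr (pval (x 0 j)).

(* K is a subfield of complex_puiseux, given by its underlying set. *)
Definition torus (K : set complex_puiseux) (N : nat) :
    set 'rV[complex_puiseux]_N :=
  [set x | forall j, K (x 0 j) /\ x 0 j != 0].

(* The product topology on row vectors is the Euclidean one. *)
Definition trop (K : set complex_puiseux) (N : nat)
    (X : set 'rV[complex_puiseux]_N) : set 'rV[R]_N :=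
  closure (@coord_val N @` (X `&` @torus K N)).

Definition trop_complex (N : nat) (X : set 'rV[complex_puiseux]_N) :=
  trop [set: complex_puiseux] X.

Definition trop_real (N : nat) (X : set 'rV[complex_puiseux]_N) :=
  trop (range real_in_complex_puiseux) X.

End Tropicalization.

Definition upper_pos (n : nat) : {set 'I_n * 'I_n} :=
  [set p : 'I_n * 'I_n | (p.1 <= p.2)%N]%SET.

Lemma card_upper_pos n : #|upper_pos n| = 'C(n.+1, 2).
Proof.
rewrite -bin2_sum big_mkord big_ord_recl add0n -sum1_card.
rewrite (eq_bigl (fun p : 'I_n * 'I_n => true && (p.1 <= p.2)%N)); last first.
  by move=> p; rewrite inE.
rewrite -(pair_big_dep xpredT (fun i j : 'I_n => (i <= j)%N) (fun _ _ => 1%N)).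
rewrite (exchange_big_dep xpredT)//=; apply: eq_bigr => j _.
have wI : injective (widen_ord (ltn_ord j)).
  by move=> x y /(congr1 val)/= /val_inj.
rewrite sum1_card -[RHS]card_ord -(fintype.card_image wI).
apply: eq_card => i; rewrite unfold_in; apply/idP/fintype.imageP => [ij|[k _ ->]].
  by exists (Ordinal (ij : (i < j.+1)%N)) => //; exact: val_inj.
exact: (ltn_ord k).
Qed.

Definition upper_entries (K : Type) (n : nat) (M : 'M[K]_n) :
    'rV[K]_#|upper_pos n| :=
  \row_k M (enum_val k).1 (enum_val k).2.

Definition sym_rank_le (K : fieldType) (r n : nat) :
    set 'rV[K]_#|upper_pos n| :=
  [set upper_entries M | M in [set M : 'M[K]_n | M^T = M /\ (\rank M <= r)%N]].
Arguments sym_rank_le K r n : clear implicits.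

(* Main.v *)
(* A symmetric matrix M of rank at most 2 over C{{t}} with nonzero entries has
   the form M_ij = x_i y_j + x_j y_i = x_i x_j (u_i + u_j), where u_i = y_i / x_i;
   this needs only square roots in C{{t}}. Replace x_i by the monomial
   t^(val x_i) and u_i by its image under the map z |-> Re z + s Im z applied to
   every coefficient. This map is additive, and for generic real s it does not
   kill the finitely many leading coefficients of the u_i + u_j, so the resulting
   real matrix has the same entrywise valuations; it again has rank at most 2.
   Hence even the sets of valuations agree before taking closures. *)
Require Import Defs.
From HB Require Import structures.
From mathcomp Require Import all_boot all_order all_algebra.
From mathcomp Require Import all_classical all_reals all_analysis.
From mathcomp Require Import complex.
From mathcomp Require Import ring zify.

Set Implicit Arguments.
Unset Strict Implicit.
Unset Printing Implicit Defensive.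

Import Order.TTheory GRing.Theory Num.Theory.

Local Open Scope classical_set_scope.
Local Open Scope ring_scope.

(** * Square roots of formal power series *)

Section PowerSeriesSqrt.
Variables (F : fieldType) (a : nat -> F) (b0 : F).

(** For n > 0, adding [c *: 'X^n] moves the coefficient of degree n of the square by [2 * b0 * c];
    [c] is chosen to correct it to [a n]. *)
Fixpoint sqrt_poly (n : nat) : {poly F} :=
  if n is n'.+1 then
    sqrt_poly n'
    + ((a n - (sqrt_poly n' ^+ 2)`_n) / (2%:R * b0)) *: 'X^n
  else b0%:P.

Lemma coef_sqrt_poly n k : (k <= n)%N -> (sqrt_poly n)`_k = (sqrt_poly k)`_k.
Proof.
elim: n => [|n IH]; first by rewrite leqn0 => /eqP ->.
rewrite leq_eqVlt => /predU1P[->//|]; rewrite ltnS => kn.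
rewrite [sqrt_poly n.+1]/= coefD coefZ coefXn.
by rewrite ltn_eqF ?ltnS// mulr0 addr0 IH.
Qed.

Lemma sqrt_poly_coef0 n : (sqrt_poly n)`_0 = b0.
Proof. by rewrite coef_sqrt_poly//= coefC. Qed.

Lemma coef_sqr_sqrt_poly n : (2%:R : F) != 0 -> b0 != 0 -> b0 ^+ 2 = a 0%N ->
  (sqrt_poly n ^+ 2)`_n = a n.
Proof.
move=> two b00 b0a; case: n => [|n].
  by rewrite /= -rmorphXn/= coefC eqxx.
rewrite [sqrt_poly _]/=; set c := _ / _; set p := sqrt_poly n.
rewrite sqrrD -scalerAr exprZn -exprM !coefD !coefZ coefMXn ltnn subnn.
rewrite coefXn sqrt_poly_coef0 [n.+1 == _]ltn_eqF; last by lia.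
by rewrite /c mulr0 addr0 -/p; field; rewrite two b00.
Qed.

(** The coefficient of degree k no longer changes after stage k, so the diagonal of the
    approximations is a root. *)
Lemma power_series_sqrt : (2%:R : F) != 0 -> b0 != 0 -> b0 ^+ 2 = a 0%N ->
  exists b : nat -> F, forall n, \sum_(i < n.+1) b i * b (n - i)%N = a n.
Proof.
move=> two b00 b0a; exists (fun k => (sqrt_poly k)`_k) => n.
rewrite -(coef_sqr_sqrt_poly n two b00 b0a) expr2 coefM; apply: eq_bigr => i _.
by rewrite !(@coef_sqrt_poly n)// ?leq_subr// -ltnS.
Qed.

End PowerSeriesSqrt.

(** * Valuations and square roots of Puiseux series *)

Section Puiseux.
Variable F : fieldType.
Implicit Types a b : puiseux F.

Lemma puiseux_of_coefs (d : nat) (m : int) (c : nat -> F) : (0 < d)%N ->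
  exists a, psupported d m a /\ forall k, a (pexp d m k) = c k.
Proof.
(* [x] recovers k from q = (m + k) / d; exponents off this grid get the coefficient 0. *)
move=> d0; pose g (q : rat) :=
  let x := q * d%:R - m%:~R in if x \is a Num.nat then c (Num.truncn x) else 0.
have dn0 : d%:R != 0 :> rat by rewrite pnatr_eq0 -lt0n.
have sg : psupported d m g.
  move=> q; rewrite /g; case: ifPn => [/natrP[k xk] _|]; last by rewrite eqxx.
  by exists k; rewrite /pexp intrD -pmulrn -xk addrC subrK mulfK.
have pg : is_puiseux g by exists d, m.
exists (mk_puiseux pg); split => //= k.
by rewrite /g /pexp divfK// intrD addrAC subrr add0r -pmulrn natr_nat natrK.
Qed.

Lemma pval_unique a q : a q != 0 -> (forall r, r < q -> a r = 0) -> pval a = q.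
Proof.
move=> aq aq0; have a0 : a != 0.
  by apply/eqP => a0; rewrite a0/= eqxx in aq.
have [av av0] := pvalP a0.
by case: (ltgtP (pval a) q) => // [/aq0|/av0] e; rewrite e eqxx in av aq.
Qed.

Lemma pval_lead a d m : (0 < d)%N -> psupported d m a -> a (pexp d m 0) != 0 ->
  pval a = pexp d m 0.
Proof.
move=> d0 sa am; apply: pval_unique => // r.
apply: contraPeq => /sa[k ->]; apply/negP; rewrite -leNgt.
by rewrite ler_pM2r ?invr_gt0 ?ltr0n// ler_int; lia.
Qed.

Lemma puiseux_leadP a : a != 0 ->
  exists d m, [/\ (0 < d)%N, psupported d m a & a (pexp d m 0) != 0].
Proof. by move=> /puiseux_neq0/(puiseux_lead (puiseuxP a)). Qed.

Lemma pexp_mul0 d e m : (0 < e)%N -> pexp (d * e) (m * e%:Z) 0 = pexp d m 0.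
Proof.
move=> e0; rewrite /pexp !addr0 intrM natrM -mulf_div divff ?mulr1//.
by rewrite pnatr_eq0 -lt0n.
Qed.

(** Over a common denominator, the lowest coefficient of the product is the product of the two
    lowest ones, nonzero in a field. *)
Lemma pvalM a b : a != 0 -> b != 0 -> pval (a * b) = pval a + pval b.
Proof.
move=> /puiseux_leadP[d [m [d0 sa am]]] /puiseux_leadP[e [l [e0 sb bl]]].
rewrite (pval_lead d0 sa am) (pval_lead e0 sb bl).
rewrite -(@pexp_mul0 d e)// -(@pexp_mul0 e d)// [(e * d)%N]mulnC pexpD addn0.
have sa' := psupported_mul e0 sa.
have := psupported_mul d0 sb; rewrite mulnC => sb'.
have de0 : (0 < d * e)%N by rewrite muln_gt0 d0.
apply: pval_lead => //; first exact: psupported_pmul.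
rewrite [_ (pexp _ _ _)](pmulE 0 de0 sa' sb') big_ord1 subn0.
by rewrite pexp_mul0// [(d * e)%N]mulnC pexp_mul0// mulf_neq0.
Qed.

Lemma puiseux_monom_neq0 (c : F) r : c != 0 -> puiseux_monom c r != 0.
Proof.
move=> c0; apply/eqP => /(congr1 (fun a : puiseux F => a r)) /=.
by rewrite /pmonom eqxx => /eqP; rewrite (negbTE c0).
Qed.

Lemma pval_monom (c : F) r : c != 0 -> pval (puiseux_monom c r) = r.
Proof.
move=> c0; apply: pval_unique; rewrite /= /pmonom ?eqxx// => q qr.
by rewrite lt_eqF.
Qed.

(** Doubling the denominator makes the leading numerator [m + m], so the root can start at exponent
    m / (2d); a power series root supplies its coefficients. *)
Lemma puiseux_sqrt a : (2%:R : F) != 0 -> (forall c : F, exists r, r ^+ 2 = c) ->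
  exists b, b ^+ 2 = a.
Proof.
move=> two sqrtF; have [->|] := eqVneq a 0; first by exists 0; rewrite expr0n.
move=> /puiseux_leadP[d [m [d0 sa am]]].
have d20 : (0 < d * 2)%N by rewrite muln_gt0 d0.
have := psupported_mul (isT : (0 < 2)%N) sa.
have := am; rewrite -(@pexp_mul0 d 2)//.
have -> : m * 2%:Z = m + m by ring.
move=> am2 sa2; have [b0 b0a] := sqrtF (a (pexp (d * 2) (m + m) 0)).
have b00 : b0 != 0 by move: am2; rewrite -b0a expf_eq0.
have [c cP] := @power_series_sqrt F (fun k => a (pexp (d * 2) (m + m) k)) b0
  two b00 b0a.
have [b [sb bc]] := @puiseux_of_coefs (d * 2) m c d20.
exists b; apply: val_inj; rewrite expr2/=.
apply: (psupported_ext (psupported_pmul sb sb) sa2) => k.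
rewrite (pmulE _ d20 sb sb) -cP; apply: eq_bigr => i _.
by rewrite !bc.
Qed.

End Puiseux.

(** * Symmetric matrices of rank at most two *)

Section SymmetricRankTwo.
Variable K : fieldType.

Lemma rank_le2P m n (M : 'M[K]_(m, n)) : (\rank M <= 2)%N ->
  exists (a a' : 'I_m -> K) (b b' : 'I_n -> K),
  forall i j, M i j = a i * b j + a' i * b' j.
Proof.
(* A rank factorization, padded with zeros to inner dimension 2. *)
move=> M2; pose A := col_ebase M *m @pid_mx K m 2 (\rank M).
pose B := @pid_mx K 2 n (\rank M) *m row_ebase M.
have MAB : M = A *m B.
  rewrite -[LHS]mulmx_ebase /A /B mulmxA.
  by rewrite -[in RHS](mulmxA (col_ebase M)) pid_mx_id.
exists (fun i => A i ord0), (fun i => A i ord_max), (B ord0), (B ord_max) => i j.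
rewrite MAB mxE big_ord_recl big_ord1.
by congr (_ + A i _ * B _ j); apply: val_inj.
Qed.

Lemma rank_hyperbolic n (x u : 'I_n -> K) :
  (\rank (\matrix_(i, j) (x i * x j * (u i + u j))%R : 'M[K]_n) <= 2)%N.
Proof.
have -> : \matrix_(i, j) (x i * x j * (u i + u j)) =
    (\col_i x i) *m (\row_j (x j * u j)) +
    (\col_i (x i * u i)) *m (\row_j x j) :> 'M[K]_n.
  by apply/matrixP => i j; rewrite !mxE !big_ord1 !mxE; ring.
apply: (leq_trans (mxrank_add _ _)); rewrite -[2%N]/(1 + 1)%N leq_add//.
  exact: leq_trans (mxrankM_maxl _ _) (rank_leq_col _).
exact: leq_trans (mxrankM_maxl _ _) (rank_leq_col _).
Qed.

(* With a pivot [k], [M k k * M i j - M i k * M k j] has rank at most one and is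
   symmetric, so [M k k * M] is [p p^T - (r alpha) (r alpha)^T], a difference of
   squares. *)
Lemma sym_rank2_hyperbolic n (M : 'M[K]_n) (k : 'I_n) : (2%:R : K) != 0 ->
  (forall c : K, exists r, r ^+ 2 = c) ->
  M^T = M -> (\rank M <= 2)%N -> M k k != 0 ->
  exists x y : 'I_n -> K, forall i j, M i j = x i * y j + x j * y i.
Proof.
move=> two sqrtK Msym /rank_le2P[a [a' [b [b' Mab]]]] Mk.
have symM i j : M i j = M j i by rewrite -[in LHS]Msym mxE.
(* Cauchy-Binet: each 2 x 2 minor through the pivot is a minor [al i] of the left factor times a
   minor [be j] of the right one. *)
pose al i := a k * a' i - a i * a' k; pose be j := b k * b' j - b' k * b j.
have minorE i j : M k k * M i j = M i k * M j k + al i * be j.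
  by rewrite (symM j k) !Mab /al /be; ring.
(* Symmetry of these minors makes [be] proportional to [al]; if [al] vanishes, 0 serves. *)
have [c alc] : exists c, forall i j, al i * be j = c * (al i * al j).
  have [/existsP[l al0]|/existsPn al0] := boolP [exists l, al l != 0];
    last first.
    by exists 0 => i j; have /negPn/eqP -> := al0 i; rewrite !mul0r.
  exists (be l / al l) => i j.
  have sab : al l * be j = al j * be l.
    apply: (@addrI _ (M l k * M j k)).
    by rewrite -minorE symM minorE mulrC.
  by apply: (mulfI al0); rewrite mulrCA sab; field.
have [r rc] := sqrtK (- c).
(* With p_i = M_ik, symmetrizing (p_i + r al_i)(p_j - r al_j) in i and j cancels the cross terms and
   leaves 2 M_kk M_ij. *)
exists (fun i => (M i k + r * al i) / (2%:R * M k k)).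
exists (fun i => M i k - r * al i).
move=> i j; apply: (mulfI Mk); rewrite minorE alc -[c]opprK -rc.
by field; rewrite two Mk.
Qed.

(** Any diagonal entry can be the pivot, and M_ii = 2 x_i y_i forces every x_i to be nonzero, so
    that u_i = y_i / x_i makes sense. *)
Lemma sym_rank2_factor n (M : 'M[K]_n) : (2%:R : K) != 0 ->
  (forall c : K, exists r, r ^+ 2 = c) ->
  M^T = M -> (\rank M <= 2)%N -> (forall i, M i i != 0) ->
  exists x u : 'I_n -> K, (forall i, x i != 0) /\
    forall i j, M i j = x i * x j * (u i + u j).
Proof.
move=> two sqrtK Msym M2 Md; case: (pickP 'I_n) => [k _|n0]; last first.
  by exists (fun=> 0), (fun=> 0); split => i; have := n0 i.
have [x [y Mxy]] := sym_rank2_hyperbolic two sqrtK Msym M2 (Md k).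
have x0 i : x i != 0.
  by apply: contraNneq (Md i); rewrite Mxy => ->; rewrite !mul0r addr0.
exists x, (fun i => y i / x i); split => // i j.
by rewrite Mxy; field; rewrite !x0.
Qed.

End SymmetricRankTwo.

(** * A real-linear projection onto real Puiseux series *)

Section RealLift.
Variable R : realType.
Implicit Types (s : R) (z : R[i]) (a b : puiseux R[i]).

Definition slanted_re s z : R := complex.Re z + s * complex.Im z.

Lemma slanted_reD s z z' :
  slanted_re s (z + z') = slanted_re s z + slanted_re s z'.
Proof. by case: z z' => [x y] [x' y']; rewrite /slanted_re /=; ring. Qed.

Lemma slanted_re0 s : slanted_re s 0 = 0.
Proof. by rewrite /slanted_re /= mulr0 addr0. Qed.

(** For nonreal z the only bad slope is - Re z / Im z, and the chosen s exceeds all of these in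
    absolute value; a nonzero real z has no bad slope. *)
Lemma slanted_re_avoid (T : finType) (z : T -> R[i]) :
  exists s, forall t, z t != 0 -> slanted_re s (z t) != 0.
Proof.
pose c t : R := `|complex.Re (z t) / complex.Im (z t)|.
exists (1 + \sum_t c t) => t zt0; have c0 i : 0 <= c i by exact: normr_ge0.
apply/eqP; rewrite /slanted_re => e.
have [im0|im0] := eqVneq (complex.Im (z t)) 0.
  move: e zt0; rewrite im0 mulr0 addr0 => re0.
  by case: (z t) im0 re0 => x y /= -> ->; rewrite eqxx.
have : c t < 1 + \sum_t c t.
  by rewrite (bigD1 t)//= addrCA ltrDl ltr_wpDr// sumr_ge0.
have s0 : 0 <= 1 + \sum_t c t by rewrite addr_ge0// sumr_ge0.
have -> : c t = `|- (1 + \sum_t c t)|.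
  rewrite /c; congr `|_|; apply: (mulIf im0).
  by rewrite divfK// mulNr; apply/eqP; rewrite -addr_eq0 e.
by rewrite normrN ger0_norm// ltxx.
Qed.

Lemma is_puiseux_slanted_re s a : is_puiseux (fun q => slanted_re s (a q)).
Proof.
have [d [m [d0 sa]]] := puiseuxP a.
exists d, m; split => // q q0; apply: sa.
by apply: contraNneq q0 => ->; rewrite slanted_re0.
Qed.

(** This map is additive but not multiplicative: it suits the u_i, which enter through sums, and not
    the factors x_i. *)
Definition puiseux_re s a : puiseux R := mk_puiseux (is_puiseux_slanted_re s a).

Lemma puiseux_reD s a b : puiseux_re s (a + b) = puiseux_re s a + puiseux_re s b.
Proof. by apply: puiseux_ext => q; rewrite /= slanted_reD. Qed.

Lemma puiseux_re_lead s a : a != 0 -> slanted_re s (a (pval a)) != 0 ->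
  puiseux_re s a != 0 /\ pval (puiseux_re s a) = pval a.
Proof.
move=> a0 sa; have [_ av0] := pvalP a0; split.
  apply/eqP => /(congr1 (fun b : puiseux R => b (pval a)))/= /eqP.
  by rewrite (negbTE sa).
by apply: pval_unique => //= r /av0 ->; rewrite slanted_re0.
Qed.

End RealLift.

(** * Extension of the coefficient field *)

Section MapPuiseuxTheory.
Variables (F G : fieldType) (iota : {rmorphism F -> G}).

Lemma map_puiseux_neq0 a : a != 0 -> map_puiseux iota a != 0.
Proof.
move=> /puiseux_neq0[q aq]; apply/eqP.
move=> /(congr1 (fun b : puiseux G => b q))/= /eqP.
by rewrite fmorph_eq0 (negbTE aq).
Qed.

Lemma pval_map_puiseux a : a != 0 -> pval (map_puiseux iota a) = pval a.
Proof.
move=> /pvalP[av av0]; apply: pval_unique => /=; first by rewrite fmorph_eq0.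
by move=> r /av0 ->; rewrite rmorph0.
Qed.

Lemma map_puiseuxB : {morph map_puiseux iota : a b / a - b}.
Proof. by move=> a b; apply: puiseux_ext => q /=; rewrite rmorphB. Qed.

Lemma map_puiseux1 : map_puiseux iota 1 = 1.
Proof.
apply: puiseux_ext => q /=; rewrite /pmonom.
by case: eqP; rewrite ?rmorph1 ?rmorph0.
Qed.

(** On a common exponent grid each coefficient of the product is a finite sum, with which [iota]
    commutes. *)
Lemma map_puiseuxM : {morph map_puiseux iota : a b / a * b}.
Proof.
move=> a b; apply: puiseux_ext => q /=.
have [d [m1 [m2 [d0 sa sb]]]] := psupported_common2 (puiseuxP a) (puiseuxP b).
have sia : psupported d m1 (map_puiseux iota a).
  by move=> r; rewrite /= fmorph_eq0 => /sa.
have sib : psupported d m2 (map_puiseux iota b).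
  by move=> r; rewrite /= fmorph_eq0 => /sb.
move: q; apply/funeqP; apply: (@psupported_ext _ d (m1 + m2)).
- move=> r; rewrite fmorph_eq0; exact: psupported_pmul.
- exact: psupported_pmul.
move=> k; rewrite (pmulE _ d0 sa sb) (pmulE _ d0 sia sib) rmorph_sum.
by apply: eq_bigr => i _; rewrite rmorphM.
Qed.

(** As a morphism of fields, the map preserves matrix ranks. *)
HB.instance Definition _ := GRing.isZmodMorphism.Build (puiseux F) (puiseux G)
  (map_puiseux iota) map_puiseuxB.
HB.instance Definition _ := GRing.isMonoidMorphism.Build (puiseux F) (puiseux G)
  (map_puiseux iota) (conj map_puiseux1 map_puiseuxM).

End MapPuiseuxTheory.

(** * Real lifts of complex matrices and equality of the tropicalizations *)

Lemma complex_puiseux_sqrt (R : realType) (a : puiseux R[i]) :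
  exists b, b ^+ 2 = a.
Proof.
apply: puiseux_sqrt; first by rewrite pnatr_eq0.
by move=> c; exists (sqrtc c); rewrite sqr_sqrtc.
Qed.

Lemma two_puiseux_neq0 (R : realType) : (2%:R : puiseux R[i]) != 0.
Proof.
apply/eqP => /(congr1 (fun a : puiseux R[i] => a 0))/=.
by rewrite /pmonom eqxx => /eqP; rewrite (_ : 1 + 1 = 2%:R)// pnatr_eq0.
Qed.

Lemma real_lift (R : realType) n (M : 'M[puiseux R[i]]_n) :
  M^T = M -> (\rank M <= 2)%N -> (forall i j, M i j != 0) ->
  exists N : 'M[puiseux R]_n, [/\ N^T = N, (\rank N <= 2)%N &
    forall i j, N i j != 0 /\ pval (N i j) = pval (M i j)].
Proof.
move=> Msym M2 M0.
have [x [u [x0 Mu]]] : exists x u : 'I_n -> puiseux R[i],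
    (forall i, x i != 0) /\ forall i j, M i j = x i * x j * (u i + u j).
  apply: sym_rank2_factor => //; first exact: two_puiseux_neq0.
  exact: complex_puiseux_sqrt.
have u0 i j : u i + u j != 0.
  by apply: contraNneq (M0 i j); rewrite Mu => ->; rewrite mulr0.
have [s sP] := @slanted_re_avoid R ('I_n * 'I_n)%type
  (fun p => (u p.1 + u p.2) (pval (u p.1 + u p.2))).
pose v i := puiseux_re s (u i).
pose X i : puiseux R := puiseux_monom 1 (pval (x i)).
have X0 i : X i != 0 by apply: puiseux_monom_neq0; rewrite oner_eq0.
have vP i j : v i + v j != 0 /\ pval (v i + v j) = pval (u i + u j).
  rewrite -puiseux_reD; apply: puiseux_re_lead; first exact: u0.
  by apply: (sP (i, j)); have [] := pvalP (u0 i j).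
exists (\matrix_(i, j) (X i * X j * (v i + v j))); split.
- by apply/matrixP => i j; rewrite !mxE (mulrC (X j)) (addrC (v j)).
- exact: rank_hyperbolic.
move=> i j; rewrite mxE; have [vn0 vE] := vP i j.
split; first exact: mulf_neq0 (mulf_neq0 (X0 i) (X0 j)) vn0.
(* Valuations add over the three factors, so these can be compared separately. *)
rewrite Mu [LHS]pvalM ?[RHS]pvalM ?mulf_neq0//; congr (_ + _) => //.
by rewrite !pvalM// !pval_monom// oner_eq0.
Qed.

Lemma eq_trop (R : realType) (K K' : set (complex_puiseux R)) (N : nat)
    (X : set 'rV[complex_puiseux R]_N) :
  @coord_val R N @` (X `&` @torus R K N) =
    @coord_val R N @` (X `&` @torus R K' N) ->
  trop K X = trop K' X.
Proof. by rewrite /trop => ->. Qed.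

Theorem corollary3p4 (R : realType) (n : nat) :
  trop_real (sym_rank_le (complex_puiseux R) 2 n)
  = trop_complex (sym_rank_le (complex_puiseux R) 2 n).
Proof.
apply: eq_trop; apply/seteqP; split.
  (* A real torus point is in particular a complex one. *)
  by move=> _ [w [Xw tw] <-]; exists w => //; split => // j; have [] := tw j.
move=> _ [_ [[M [Msym M2] <-] tM] <-].
have M0 i j : M i j != 0.
  (* The torus condition only sees entries on or above the diagonal; symmetry gives the others. *)
  wlog ij : i j / (i <= j)%N.
    move=> H; have [/H//|/ltnW/H] := leqP i j.
    by rewrite -[in M j i]Msym mxE.
  have pij : (i, j) \in upper_pos n by rewrite inE.
  by have [_] := tM (enum_rank_in pij (i, j)); rewrite mxE enum_rankK_in.
have [N [Nsym N2 NP]] := real_lift Msym M2 M0.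
pose N' := map_mx (map_puiseux (real_complex R)) N.
exists (upper_entries N'); first split.
- exists N' => //; split.
    by apply/matrixP => i j; rewrite !mxE -[in LHS]Nsym mxE.
  by rewrite /N' mxrank_map.
- move=> k; rewrite !mxE; split.
    by exists (N (enum_val k).1 (enum_val k).2).
  by apply: map_puiseux_neq0; have [] := NP (enum_val k).1 (enum_val k).2.
apply/rowP => k; rewrite !mxE; congr (ratr _).
by have [N0 <-] := NP (enum_val k).1 (enum_val k).2; exact: pval_map_puiseux.
Qed.
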